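(* Let $W$ and $W'$ be non-negative random variables defined on the same probability space and having the same law, and let $D := W'-W$. Let $Z$ be an exponential random variable with mean $1$. Then for every $t>0$ and every constant $\lambda>0$, $$\left|\mathbb{P}[W\le t]-\mathbb{P}[Z\le t]\right| \le \mathbb{E}\left|\left(\lambda^{-1}\mathbb{E}(D|W)+1\right)\mathbb{I}[W>0]\right| + \mathbb{E}\left|\tfrac{1}{2\lambda}\mathbb{E}(D^2|W)-1\right| + \tfrac{1}{6\lambda}\mathbb{E}|D|^3 + \tfrac{1}{2\lambda}\mathbb{E}\left(D^2\,\mathbb{I}[|W-t|\le |D|]\right).$$
   Context: $\mathbb{I}[A]$ is the indicator function of the event $A$. $\mathbb{E}(\cdot|W)$ is conditional expectation given $W$. Expectations of non-negative random variables take values in $[0,\infty]$, so the bound is trivial when its right-hand side is infinite. *)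

(* Defs.v *)
From HB Require Import structures.
From mathcomp Require Import all_boot all_order all_algebra.
From mathcomp Require Import all_classical all_reals all_analysis.
From mathcomp Require Import measurable_realfun.

Set Implicit Arguments.
Unset Strict Implicit.
Unset Printing Implicit Defensive.

Import Order.TTheory GRing.Theory Num.Theory.
Import numFieldNormedType.Exports.

Local Open Scope classical_set_scope.
Local Open Scope ring_scope.
Local Open Scope ereal_scope.

(* Kolmogorov's definition for a random variable [X] with values in [0, +oo]:
   [Y] is a version of E(X | W).  Such versions always exist, whether or not
   [X] is integrable. *)
Definition is_cond_exp_ge0 (d d' : measure_display) (T : measurableType d)
    (T' : measurableType d') (R : realType) (P : probability T R)
    (W : T -> T') (X Y : T -> \bar R) : Prop :=
  [/\ forall w, 0 <= Y w,
      measurable_fun [set: g_sigma_algebra_preimageType W]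
        (Y : g_sigma_algebra_preimageType W -> \bar R)
    & forall A, g_sigma_algebra_preimage W A ->
        \int[P]_(w in A) Y w = \int[P]_(w in A) X w].

(* [Y] is a version of E(X | W) = E(X^+ | W) - E(X^- | W).  For integrable [X]
   this is the usual conditional expectation.  Where both terms are +oo, which
   for integrable [X] happens with probability 0, the difference takes the
   library's value of +oo - +oo, namely -oo. *)
Definition is_cond_exp (d d' : measure_display) (T : measurableType d)
    (T' : measurableType d') (R : realType) (P : probability T R)
    (W : T -> T') (X Y : T -> \bar R) : Prop :=
  exists Yp Yn : T -> \bar R,
    [/\ is_cond_exp_ge0 P W X^\+ Yp, is_cond_exp_ge0 P W X^\- Yn
      & forall w, Y w = Yp w - Yn w].

(* Main.v *)
(* Stein's equation f' - f = 1_(x <= t) - P(Z <= t), f(0) = 0, has on [0, +oo[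
   the solution f(x) = exp(min(x - t, 0)) - exp(-t), for which f and f' take
   values in [0, 1].  Let G be an antiderivative of f.  As W and W' have the
   same law, 0 = E(G(W') - G(W)) = E(D f(W)) + E(D^2 f'(W)) / 2 + E(r), where r
   is the Taylor remainder.  Dividing by lambda and subtracting from E(f'(W) - f(W)),
   which is P(W <= t) - P(Z <= t), gives
   - E(f(W) (D / lambda + 1)) - E(f'(W) (D^2 / (2 lambda) - 1)) - E(r) / lambda,
   where D and D^2 may be replaced by their conditional expectations.
   Always |r| <= D^2 / 2, and |r| <= |D|^3 / 6 unless the jump t of f' lies
   between W and W', in which case |W - t| <= |D|. *)

Require Import Defs.
From HB Require Import structures.
From mathcomp Require Import all_boot all_order all_algebra.
From mathcomp Require Import all_classical all_reals all_analysis.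
From mathcomp Require Import measurable_realfun ring lra.

Set Implicit Arguments.
Unset Strict Implicit.
Unset Printing Implicit Defensive.

Import Order.TTheory GRing.Theory Num.Theory.
Import numFieldNormedType.Exports.

Local Open Scope classical_set_scope.
Local Open Scope ring_scope.

(** * Taylor bounds for the exponential on the negative half-line *)

(** Serves every bound below: the difference of the two sides vanishes at 0, and its derivative is
    nonnegative by an earlier or standard inequality. *)
Lemma derivable_ge0 (R : realType) (f df : R -> R) :
  (forall x : R, is_derive x 1 f (df x)) ->
  (forall x, 0 <= x -> 0 <= df x) -> f 0 = 0 ->
  forall x, 0 <= x -> 0 <= f x.
Proof.
move=> f_df df_ge0 f0 x x_ge0; rewrite -f0.
have dF (y : R) : derivable f y 1 by have ? := f_df y; exact: ex_derive.
apply: (@ger0_derive1_le_cc _ f 0 x); rewrite ?in_itv/= ?lexx ?x_ge0//.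
- move=> y; rewrite in_itv/= => /andP[y0 _]; have ? := f_df y.
  by rewrite derive1E derive_val df_ge0// ltW.
- apply: continuous_subspaceT => y; apply: differentiable_continuous.
  exact/derivable1_diffP.
Qed.

Section expR_taylor.
Variable R : realType.
Implicit Types x s y : R.

Lemma expRN_le_taylor2 x : 0 <= x -> expR (- x) <= 1 - x + x ^+ 2 / 2.
Proof.
move=> x0; rewrite -subr_ge0.
apply: (@derivable_ge0 R (fun x => 1 - x + x ^+ 2 / 2 - expR (- x))
  (fun x => expR (- x) - (1 - x))) => // [y|y _|].
- by apply: is_derive_eq; rewrite /GRing.scale/=; field.
- by rewrite subr_ge0; exact: expR_ge1Dx.
- by rewrite oppr0 expR0; ring.
Qed.

Lemma expRN_ge_taylor3 x :
  0 <= x -> 1 - x + x ^+ 2 / 2 - x ^+ 3 / 6 <= expR (- x).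
Proof.
move=> x0; rewrite -subr_ge0.
apply: (@derivable_ge0 R
  (fun x => expR (- x) - (1 - x + x ^+ 2 / 2 - x ^+ 3 / 6))
  (fun x => 1 - x + x ^+ 2 / 2 - expR (- x))) => // [y|y y0|].
- by apply: is_derive_eq; rewrite /GRing.scale/=; field.
- by rewrite subr_ge0; exact: expRN_le_taylor2.
- by rewrite oppr0 expR0; ring.
Qed.

(** For expansions from a point [s] to a larger point [y = s + x]: the first-order remainder of
    [expR] is then [expR y * (1 - (1 + x) * expR (- x))], where [expR y] is at most 1 if
    [y <= 0]. *)
Lemma taylor1_expRN_ge x : 0 <= x -> 1 - x ^+ 2 / 2 <= (1 + x) * expR (- x).
Proof.
move=> x0; rewrite -subr_ge0.
apply: (@derivable_ge0 R (fun x => (1 + x) * expR (- x) - (1 - x ^+ 2 / 2))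
  (fun x => x * (1 - expR (- x)))) => // [y|y y0|].
- by apply: is_derive_eq; rewrite /GRing.scale/=; field.
- by rewrite mulr_ge0// subr_ge0 expR_le1 oppr_le0.
- by rewrite oppr0 expR0; ring.
Qed.

(** This bound and the next control the second-order remainder in the same way, when the expansion
    goes from a point to a larger one. *)
Lemma taylor2_expRN_le1 x : 0 <= x -> (1 + x + x ^+ 2 / 2) * expR (- x) <= 1.
Proof.
move=> x0; rewrite -subr_ge0.
apply: (@derivable_ge0 R (fun x => 1 - (1 + x + x ^+ 2 / 2) * expR (- x))
  (fun x => x ^+ 2 / 2 * expR (- x))) => // [y|y y0|].
- by apply: is_derive_eq; rewrite /GRing.scale/=; field.
- by rewrite !mulr_ge0// ?expR_ge0// sqr_ge0.
- by rewrite oppr0 expR0; ring.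
Qed.

Lemma taylor2_expRN_ge x :
  0 <= x -> 1 - x ^+ 3 / 6 <= (1 + x + x ^+ 2 / 2) * expR (- x).
Proof.
move=> x0; rewrite -subr_ge0.
apply: (@derivable_ge0 R
  (fun x => (1 + x + x ^+ 2 / 2) * expR (- x) - (1 - x ^+ 3 / 6))
  (fun x => x ^+ 2 / 2 * (1 - expR (- x)))) => // [y|y y0|].
- by apply: is_derive_eq; rewrite /GRing.scale/=; field.
- by rewrite !mulr_ge0 ?sqr_ge0// subr_ge0 expR_le1 oppr_le0.
- by rewrite oppr0 expR0; ring.
Qed.

End expR_taylor.

(** * The solution of Stein's equation and its Taylor remainders *)

(* In the variable [s = x - t], the solution of Stein's equation is
   [stein1 - expR (- t)], and [stein2] and [stein0] are an antiderivative and
   the derivative of [stein1], the left derivative at the jump [s = 0]. *)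
Section stein_solution.
Variable R : realType.
Implicit Types s y : R.

Definition stein1 s : R := expR (Num.min s 0).
Definition stein2 s : R := stein1 s + Num.max s 0.
Definition stein0 s : R := stein1 s * (s <= 0)%R%:R.

Lemma stein1_bounds s : 0 <= stein1 s <= 1.
Proof. by rewrite /stein1 expR_ge0 expR_le1 ge_min lexx orbT. Qed.

Lemma stein0_bounds s : 0 <= stein0 s <= 1.
Proof.
rewrite /stein0; have := stein1_bounds s.
by case: (s <= 0); rewrite (mulr1, mulr0)// lexx ler01.
Qed.

Lemma stein2_npos s : s <= 0 -> stein2 s = expR s.
Proof. by move=> s0; rewrite /stein2 /stein1 min_l// max_r// addr0. Qed.

Lemma stein1_npos s : s <= 0 -> stein1 s = expR s.
Proof. by move=> s0; rewrite /stein1 min_l. Qed.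

Lemma stein2_nneg s : 0 <= s -> stein2 s = 1 + s.
Proof. by move=> s0; rewrite /stein2 /stein1 min_r// max_l// expR0. Qed.

Lemma stein1_nneg s : 0 <= s -> stein1 s = 1.
Proof. by move=> s0; rewrite /stein1 min_r// expR0. Qed.

Lemma stein0_npos s : s <= 0 -> stein0 s = expR s.
Proof. by move=> s0; rewrite /stein0 stein1_npos// s0 mulr1. Qed.

Lemma stein0_pos s : 0 < s -> stein0 s = 0.
Proof. by move=> s0; rewrite /stein0 leNgt s0 mulr0. Qed.

(** [stein2] is convex, and its derivative [stein1] is 1-Lipschitz; the proof makes this explicit in
    the four sign cases. *)
Lemma stein2_taylor1 s y :
  0 <= stein2 y - stein2 s - (y - s) * stein1 s <= (y - s) ^+ 2 / 2.
Proof.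
have [s0|s0] := leP s 0; have [y0|y0] := leP y 0.
- rewrite !stein2_npos// stein1_npos//; apply/andP; split.
    rewrite (_ : _ - _ = expR s * (expR (y - s) - (1 + (y - s)))).
      by rewrite mulr_ge0 ?expR_ge0// subr_ge0 expR_ge1Dx.
    by rewrite mulrBr -expRD addrCA subrr addr0; ring.
  (* For the upper bound, the exponential of the larger of the two points is taken out and replaced
     by 1. This needs the other factor to be nonnegative. *)
  have [ys|ys] := leP y s.
    have := @expRN_le_taylor2 R (s - y); rewrite opprB subr_ge0 => /(_ ys).
    have := expR_ge1Dx (y - s).
    have := expR_gt0 s; have : expR s <= 1 by rewrite expR_le1.
    rewrite -[in expR y](subrK s y) (expRD (y - s) s).
    move: (expR s) (expR (y - s)) => a b.
    rewrite -(opprB s y); move: (s - y) => u a1 a0 b1 b2.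
    apply: (@le_trans _ _ (1 * (b - 1 + u))); last by lra.
    rewrite (_ : _ - _ = a * (b - 1 + u)); last by ring.
    by apply: ler_wpM2r => //; lra.
  have := @taylor1_expRN_ge R (y - s); rewrite opprB subr_ge0 => /(_ (ltW ys)).
  have : (1 + (y - s)) * expR (s - y) <= 1.
    rewrite -[leRHS](expRxMexpNx_1 (y - s)) opprB ler_wpM2r ?expR_ge0//.
    exact: expR_ge1Dx.
  have := expR_gt0 y; have : expR y <= 1 by rewrite expR_le1.
  rewrite -[in expR s](subrK y s) (expRD (s - y) y).
  move: (expR y) (expR (s - y)) => a b.
  move: (y - s) => u a1 a0 b1 b2.
  apply: (@le_trans _ _ (1 * (1 - (1 + u) * b))); last by lra.
  rewrite (_ : _ - _ = a * (1 - (1 + u) * b)); last by ring.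
  by apply: ler_wpM2r => //; lra.
(* The path from [s] to [y] is split at 0: the remainder from [s] to 0 is at most [s ^+ 2 / 2], and
   the linear part beyond 0 contributes [y * (1 - expR s)], at most [- s * y]. Their sum is at most
   [(y - s) ^+ 2 / 2]. *)
- rewrite (stein2_nneg (ltW y0)) stein2_npos// stein1_npos//.
  have := @taylor1_expRN_ge R (- s); rewrite opprK oppr_ge0 => /(_ s0).
  have : (1 - s) * expR s <= 1.
    rewrite -[leRHS](expRxMexpNx_1 (- s)) opprK ler_wpM2r ?expR_ge0//.
    exact: expR_ge1Dx.
  have : expR s <= 1 by rewrite expR_le1.
  have : 1 + s <= expR s by exact: expR_ge1Dx.
  move: (expR s) => a a2 a1 a3 a4.
  have ya : 0 <= y * (1 - a) by rewrite mulr_ge0 ?subr_ge0// ltW.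
  have ya' : y * (1 - a) <= y * (- s) by apply: ler_wpM2l; lra.
  have y2 := sqr_ge0 y.
  have -> : 1 + y - a - (y - s) * a = 1 - (1 - s) * a + y * (1 - a) by ring.
  by apply/andP; split; lra.
- rewrite stein2_npos// (stein2_nneg (ltW s0)) (stein1_nneg (ltW s0)).
  have := expR_ge1Dx y.
  have := @expRN_le_taylor2 R (- y); rewrite opprK oppr_ge0 => /(_ y0).
  by move=> ? ?; apply/andP; split; nra.
- rewrite (stein2_nneg (ltW y0)) (stein2_nneg (ltW s0)) (stein1_nneg (ltW s0)).
  have := sqr_ge0 (y - s).
  by move=> ?; apply/andP; split; nra.
Qed.

(** The second-order remainder [r] of the antiderivative G. The linear part of G cancels in it, so
    [stein2] can stand for G. *)
Definition stein_remainder s y : R :=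
  stein2 y - stein2 s - (y - s) * stein1 s - (y - s) ^+ 2 / 2 * stein0 s.

(** The first-order remainder and the second-order term both lie between 0 and [(y - s) ^+ 2 / 2],
    hence so does the absolute value of their difference. *)
Lemma stein_remainder_le2 s y : `|stein_remainder s y| <= (y - s) ^+ 2 / 2.
Proof.
rewrite /stein_remainder; have := stein2_taylor1 s y.
have := stein0_bounds s; have := sqr_ge0 (y - s).
by rewrite ler_norml => ? /andP[? ?] /andP[? ?]; apply/andP; split; nra.
Qed.

(** On the positive side [stein2] is affine and the remainder vanishes. On the other side it is
    [expR], and taking out the exponential of the larger point, at most 1, leaves a remainder
    bounded by the cubic Taylor bounds. *)
Lemma stein_remainder_le3 s y :
  (s <= 0) = (y <= 0) -> `|stein_remainder s y| <= `|y - s| ^+ 3 / 6.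
Proof.
rewrite /stein_remainder.
have [s0|s0] := leP s 0; have [y0|y0] := leP y 0 => // _; last first.
  rewrite (stein2_nneg (ltW y0)) (stein2_nneg (ltW s0)) (stein1_nneg (ltW s0)).
  rewrite stein0_pos//.
  rewrite (_ : _ - _ = 0); last by ring.
  by rewrite normr0 divr_ge0// exprn_ge0.
rewrite !stein2_npos// stein1_npos// stein0_npos//.
have [ys|ys] := leP y s.
  have [u u0 ->] : exists2 u, 0 <= u & y = s - u.
    by exists (s - y); rewrite ?subr_ge0//; ring.
  have := expRN_le_taylor2 u0; have := expRN_ge_taylor3 u0.
  have := expR_gt0 s; have : expR s <= 1 by rewrite expR_le1.
  rewrite (_ : s - u - s = - u); last by ring.
  rewrite normrN (ger0_norm u0) expRD.
  move: (expR s) (expR (- u)) => a b a1 a0 b3 b2.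
  have E : - (a * b - a - - u * a - (- u) ^+ 2 / 2 * a) =
    a * (1 - u + u ^+ 2 / 2 - b) by ring.
  rewrite -normrN ger0_norm.
    rewrite E.
    apply: (@le_trans _ _ (1 * (1 - u + u ^+ 2 / 2 - b))); last by lra.
    by apply: ler_wpM2r => //; lra.
  by rewrite E; apply: mulr_ge0; lra.
have [u u0 ->] : exists2 u, 0 <= u & s = y - u.
  by exists (y - s); rewrite ?subr_ge0 ?(ltW ys)//; ring.
have := taylor2_expRN_le1 u0; have := taylor2_expRN_ge u0.
have := expR_gt0 y; have : expR y <= 1 by rewrite expR_le1.
rewrite (_ : y - (y - u) = u); last by ring.
rewrite (ger0_norm u0) expRD.
move: (expR y) (expR (- u)) => a b a1 a0 b3 b2.
have -> : a - a * b - u * (a * b) - u ^+ 2 / 2 * (a * b) =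
  a * (1 - (1 + u + u ^+ 2 / 2) * b) by ring.
rewrite ger0_norm; last by apply: mulr_ge0; lra.
apply: (@le_trans _ _ (1 * (1 - (1 + u + u ^+ 2 / 2) * b))); last by lra.
by apply: ler_wpM2r => //; lra.
Qed.

(** If [|y - s| < |s|], then [s] and [y] are on the same side of the jump at 0 and the cubic bound
    applies; otherwise the quadratic one does. *)
Lemma stein_remainder_le s y :
  `|stein_remainder s y|
    <= `|y - s| ^+ 3 / 6 + (y - s) ^+ 2 / 2 * (`|s| <= `|y - s|)%R%:R.
Proof.
have [_|h] := leP `|s| `|y - s|.
  rewrite mulr1 (le_trans (stein_remainder_le2 s y))// lerDr.
  by rewrite divr_ge0// exprn_ge0.
rewrite mulr0 addr0; apply: stein_remainder_le3.
have [s0|s0] := leP s 0; have [y0|y0] // := leP y 0.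
  by have := ler_norm (y - s); move: h; rewrite (ler0_norm s0); lra.
have := ler_norm (s - y); rewrite distrC; move: h.
by rewrite (gtr0_norm s0); lra.
Qed.

Lemma measurable_stein1 : measurable_fun [set: R] stein1.
Proof. by apply: measurableT_comp => //; exact: measurable_minr. Qed.

Lemma measurable_stein2 : measurable_fun [set: R] stein2.
Proof.
by apply: measurable_funD measurable_stein1 _; exact: measurable_maxr.
Qed.

Lemma measurable_stein0 : measurable_fun [set: R] stein0.
Proof.
apply: measurable_funM measurable_stein1 _.
rewrite (_ : (fun s => _) = \1_(`]-oo, 0]%classic : set R)).
  exact: measurable_indic.
by apply/funext => s; rewrite indicE mem_setE in_itv.
Qed.

End stein_solution.

(** * Pulling functions of W out of conditional expectations *)

Section cond_exp.
Context (d : measure_display) (T : measurableType d) (R : realType)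
  (P : probability T R) (W : {RV P >-> R}).
Local Open Scope ereal_scope.

Import HBNNSimple.

(** Reduces a simple weight to integrals of [X] over preimages under [W], the only integrals that
    the definition of conditional expectation compares. *)
Lemma ge0_integral_nnsfun_comp (X : T -> \bar R) (h : {nnsfun R >-> R}) :
  measurable_fun [set: T] X -> (forall w, 0 <= X w) ->
  \int[P]_w ((h (W w))%:E * X w) =
    \sum_(r \in range h) (r%:E * \int[P]_(w in W @^-1` (h @^-1` [set r])) X w).
Proof.
move=> mX X0.
have mhW r : measurable_fun [set: T]
    (fun w => (r * \1_(h @^-1` [set r]) (W w))%:E).
  apply/measurable_EFinP/measurable_funM => //.
  by apply: measurableT_comp => //; exact: measurable_indic.
transitivity (\int[P]_w \sum_(r \in range h)
    ((r * \1_(h @^-1` [set r]) (W w))%:E * X w)).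
  apply: eq_integral => w _; rewrite -ge0_mule_fsuml => [|r].
    by rewrite fsumEFin// -(fimfunE _ (W w)).
  exact: nnfun_muleindic_ge0.
rewrite ge0_integral_fsum//; last 2 first.
- by move=> r; apply: emeasurable_funM.
- by move=> r w _; rewrite mule_ge0// nnfun_muleindic_ge0.
apply: eq_fsbigr => r; rewrite inE => -[x _ <-{r}].
under eq_integral do rewrite EFinM -muleA.
rewrite ge0_integralZl//; last 3 first.
- apply: emeasurable_funM => //; apply/measurable_EFinP.
  by apply: measurableT_comp => //; exact: measurable_indic.
- by move=> w _; rewrite mule_ge0.
- by rewrite lee_fin.
congr (_ * _); rewrite [RHS]integral_mkcond; apply: eq_integral => w _.
by rewrite muleC epatch_indic.
Qed.

(** Monotone convergence along simple functions increasing to [g] extends the equality from simple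
    weights to [g]. *)
Lemma ge0_integral_pull_out (X Y : T -> \bar R) (g : R -> R) :
  measurable_fun [set: T] X -> (forall w, 0 <= X w) ->
  measurable_fun [set: T] Y -> (forall w, 0 <= Y w) ->
  (forall B, measurable B ->
    \int[P]_(w in W @^-1` B) X w = \int[P]_(w in W @^-1` B) Y w) ->
  measurable_fun [set: R] g -> (forall x, (0 <= g x)%R) ->
  \int[P]_w ((g (W w))%:E * X w) = \int[P]_w ((g (W w))%:E * Y w).
Proof.
move=> mX X0 mY Y0 XY mg g0.
have mgE : measurable_fun [set: R] (EFin \o g) by exact/measurable_EFinP.
pose h := nnsfun_approx measurableT mgE.
have h_g x : EFin \o h ^~ x @ \oo --> (g x)%:E.
  by apply: (@cvg_nnsfun_approx _ _ _ _ _ _ mgE) => //= y _; rewrite lee_fin.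
have limE Z : measurable_fun [set: T] Z -> (forall w, 0 <= Z w) ->
    \int[P]_w ((g (W w))%:E * Z w) =
      limn (fun n => \int[P]_w ((h n (W w))%:E * Z w)).
  move=> mZ Z0; rewrite -monotone_convergence//.
  - apply: eq_integral => w _; apply/esym/cvg_lim => //.
    (* Where [g] vanishes, [Z] may be +oo and the product rule for limits fails; but then
       [0 <= h n <= g] makes every approximating product equal to 0. *)
    have [gW0|gW0] := eqVneq (g (W w)) 0%R.
      rewrite gW0 mul0e; apply: cvg_near_cst; apply: nearW => n.
      suff -> : h n (W w) = 0%R by rewrite mul0e.
      apply/eqP; rewrite eq_le fun_ge0 andbT -gW0 -lee_fin nnsfun_approxE.
      by apply: le_approx => // x _; rewrite lee_fin.
    apply: cvgeM; [|exact: h_g|exact: cvg_cst].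
    have [Zfin|Zoo] := boolP (Z w \is a fin_num); first by rewrite mule_def_fin.
    by rewrite mule_def_neq0_infty// eqe.
  - move=> n; apply: emeasurable_funM => //; apply/measurable_EFinP.
    exact: measurableT_comp.
  - by move=> n w _; rewrite mule_ge0// lee_fin.
  - move=> w _ m n mn; rewrite lee_wpmul2r// lee_fin.
    exact/lefP/nd_nnsfun_approx.
rewrite !limE//; congr (limn _); apply/funext => n.
by rewrite !ge0_integral_nnsfun_comp//; under eq_fsbigr do rewrite XY//.
Qed.

Lemma cond_exp_ge0_pull_out (X Y : T -> \bar R) (g : R -> R) :
  measurable_fun [set: T] X -> (forall w, 0 <= X w) ->
  is_cond_exp_ge0 P W X Y ->
  measurable_fun [set: R] g -> (forall x, (0 <= g x)%R) ->
  measurable_fun [set: T] Y /\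
  \int[P]_w ((g (W w))%:E * Y w) = \int[P]_w ((g (W w))%:E * X w).
Proof.
move=> mX X0 [Y0 mY XY] mg g0.
have mYT : measurable_fun [set: T] Y.
  move=> _ B mB; have [C mC <-] := mY measurableT B mB.
  by rewrite setTI; exact: measurable_funPTI.
split=> //; apply: ge0_integral_pull_out => // B mB.
by apply: XY; exists B => //; rewrite setTI.
Qed.

Lemma integrable_mul_bounded (X : T -> \bar R) (g : T -> R) :
  measurable_fun [set: T] g -> (forall w, (`|g w| <= 1)%R) ->
  P.-integrable [set: T] X ->
  P.-integrable [set: T] (fun w => (g w)%:E * X w).
Proof.
move=> mg g1 iX; apply: (le_integrable _ _ _ iX) => //.
  apply: emeasurable_funM; [exact/measurable_EFinP|exact: measurable_int iX].
by move=> w _; rewrite abseM gee_pMl// lee_fin.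
Qed.

(** Replaces conditional expectations by [D] and [D ^+ 2] in the affine expressions of the bound.
    The positive and negative parts are pulled out separately and then subtracted. *)
Lemma cond_exp_pull_out (X : T -> R) (Y : T -> \bar R) (g : R -> R) (a b : R) :
  P.-integrable [set: T] (EFin \o X) ->
  is_cond_exp P W (EFin \o X) Y ->
  measurable_fun [set: R] g -> (forall x, (0 <= g x <= 1)%R) ->
  measurable_fun [set: T] Y /\
  \int[P]_w ((g (W w))%:E * (a%:E * Y w + b%:E)) =
  \int[P]_w (g (W w) * (a * X w + b))%:E.
Proof.
move=> iX [Yp [Yn [cYp cYn YE]]] mg g01.
have g0 x : (0 <= g x)%R by case/andP: (g01 x).
have mXp := measurable_int _ (integrable_funepos measurableT iX).
have mXn := measurable_int _ (integrable_funeneg measurableT iX).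
have [mYp pYp] := cond_exp_ge0_pull_out mXp (funepos_ge0 _) cYp mg g0.
have [mYn pYn] := cond_exp_ge0_pull_out mXn (funeneg_ge0 _) cYn mg g0.
have mgW : measurable_fun [set: T] (g \o W) by exact: measurableT_comp.
have gW1 w : (`|(g \o W) w| <= 1)%R.
  by have /andP[? ?] := g01 (W w); rewrite /= ger0_norm.
(* Taking the whole space as the event shows that [Yp] and [Yn] have the finite integrals of the two
   parts of [X]. *)
have gs : g_sigma_algebra_preimage W [set: T].
  by exists setT; rewrite ?setTI ?preimage_setT.
have iYp : P.-integrable [set: T] Yp.
  have [Yp0 _ /(_ setT gs) Ypint] := cYp; apply/integrableP; split=> //.
  under eq_integral do rewrite gee0_abs//.
  by rewrite Ypint; exact: integral_funepos_lt_pinfty iX.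
have iYn : P.-integrable [set: T] Yn.
  have [Yn0 _ /(_ setT gs) Ynint] := cYn; apply/integrableP; split=> //.
  under eq_integral do rewrite gee0_abs//.
  by rewrite Ynint; exact: integral_funeneg_lt_pinfty iX.
have YE' : Y = Yp \- Yn by apply/funext.
have iY : P.-integrable [set: T] Y by rewrite YE'; exact: integrableB.
have igY := integrable_mul_bounded mgW gW1 iY.
have igX := integrable_mul_bounded mgW gW1 iX.
have ig : P.-integrable [set: T] (fun w => (b * g (W w))%:E).
  have := integrable_mul_bounded mgW gW1
    (finite_measure_integrable_cst P b measurableT).
  by apply: eq_integrable => // w _; rewrite /= -EFinM mulrC.
have igYE : \int[P]_w ((g (W w))%:E * Y w) =
    \int[P]_w ((g (W w))%:E * (X w)%:E).
  transitivity (\int[P]_w (((g (W w))%:E * Yp w) - ((g (W w))%:E * Yn w))).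
    apply: eq_integral => w _; rewrite YE.
    (* Both sides are 0 if the weight is 0. A positive weight preserves infinite values, also in the
       case +oo - +oo = -oo. *)
    have [->|gW0] := eqVneq (g (W w)) 0%R; first by rewrite !mul0e sube0.
    have {}gW0 : (0 < g (W w))%R by rewrite lt_neqAle eq_sym gW0 g0.
    have [Yp0 _ _] := cYp; have [Yn0 _ _] := cYn.
    move: (Yp w) (Yn w) (Yp0 w) (Yn0 w) => [y| |] [z| |]//= _ _;
      by rewrite ?gt0_muley ?gt0_muleNy// -!EFinM -!EFinB mulrBr.
  rewrite integralB//; [|exact: (integrable_mul_bounded mgW gW1)..].
  rewrite pYp pYn -integralB//; last 2 first.
  - exact: (integrable_mul_bounded mgW gW1 (integrable_funepos measurableT iX)).
  - exact: (integrable_mul_bounded mgW gW1 (integrable_funeneg measurableT iX)).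
  apply: eq_integral => w _; rewrite -muleBr ?add_def_funeposneg//.
  by rewrite -[in RHS]/((EFin \o X) w) [in RHS](funeposneg (EFin \o X)).
split; first exact: measurable_int iY.
transitivity (\int[P]_w (a%:E * ((g (W w))%:E * Y w) + (b * g (W w))%:E)).
  apply: eq_integral => w _; rewrite muleDr//; last exact: fin_num_adde_defl.
  by rewrite muleCA -EFinM (mulrC b).
rewrite integralD//; last exact: integrableZl.
rewrite integralZl// igYE -integralZl// -integralD//; last exact: integrableZl.
by apply: eq_integral => w _; rewrite /= -!EFinM -EFinD; congr EFin; ring.
Qed.

End cond_exp.

(** * Truncation and the equality of laws *)

Section truncation.
Variable R : realType.
Implicit Types a b : R.

Definition trunc (n : nat) (a : R) : R := Num.max (- n%:R) (Num.min a n%:R).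

Lemma trunc_norm n a : `|trunc n a| <= n%:R.
Proof.
have n0 : (0 : R) <= n%:R by [].
rewrite /trunc ler_norml; case: (leP a n%:R) => an.
  by case: (leP (- n%:R) a) => na; lra.
by rewrite max_r; lra.
Qed.

(** Provides the dominating function when the truncation level tends to infinity. *)
Lemma trunc_lip n a b : `|trunc n a - trunc n b| <= `|a - b|.
Proof.
have n0 : (0 : R) <= n%:R by [].
rewrite /trunc ler_norml.
have := ler_norm (a - b); have := ler_norm (b - a); rewrite (distrC b a).
case: (leP a n%:R) => ?; case: (leP b n%:R) => ? ? ?;
  do ![case: (leP (- n%:R) _) => ?]; apply/andP; split; lra.
Qed.

Lemma trunc_id n a : `|a| <= n%:R -> trunc n a = a.
Proof. by rewrite ler_norml => /andP[? ?]; rewrite /trunc min_l// max_r. Qed.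

Lemma measurable_trunc n : measurable_fun [set: R] (trunc n).
Proof. by apply: measurable_maxr => //; exact: measurable_minr. Qed.

End truncation.

(* [h \o W] alone need not be integrable, hence the truncation. *)
Lemma integral_eq_law_sub (d : measure_display) (T : measurableType d)
    (R : realType) (P : probability T R) (W W' : {RV P >-> R}) (h : R -> R) :
  (forall A, measurable A -> distribution P W A = distribution P W' A) ->
  measurable_fun [set: R] h ->
  P.-integrable [set: T] (fun w => (h (W' w) - h (W w))%:E) ->
  (\int[P]_w (h (W' w) - h (W w))%:E = 0)%E.
Proof.
move=> eqlaw mh ih.
pose u n x := trunc n (h x).
have mu n : measurable_fun [set: R] (u n).
  by apply: measurableT_comp mh; exact: measurable_trunc.
have iu n (V : {RV P >-> R}) : P.-integrable [set: T] (EFin \o (u n \o V)).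
  apply: (le_integrable _ _ _
    (finite_measure_integrable_cst P n%:R measurableT)) => //.
    exact/measurable_EFinP/measurableT_comp.
  by move=> w _; rewrite lee_fin /= (ger0_norm (ler0n _ _)) trunc_norm.
(* After truncation both expectations are finite and are integrals of [u n] against the common
   law. *)
have u0 n : (\int[P]_w (u n (W' w) - u n (W w))%:E = 0)%E.
  rewrite integralB_EFin//; [|exact: iu..].
  have muE : measurable_fun [set: R] (EFin \o u n) by exact/measurable_EFinP.
  have /= <- := integral_distribution muE (iu n W).
  have /= <- := integral_distribution muE (iu n W').
  rewrite (@eq_measure_integral _ _ _ _ (distribution P W))//.
    rewrite subee// integral_distribution//; last exact: iu.
    by apply: integrable_fin_num => //; exact: iu.
  by move=> A mA _; exact/esym/eqlaw.
have [//|||||_ _] := @dominated_convergence _ _ _ P _ measurableT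
    (fun n w => (u n (W' w) - u n (W w))%:E) (fun w => (h (W' w) - h (W w))%:E)
    (fun w => `|(h (W' w) - h (W w))%:E|%E).
- move=> n; apply/measurable_EFinP/measurable_funB;
    exact: measurableT_comp.
- exact: measurable_int ih.
- apply: aeW => w _; apply: cvg_near_cst; near=> n.
  by rewrite /u !trunc_id//; near: n; exact: nbhs_infty_ger.
- exact: integrable_abse.
- by apply: aeW => w n _; rewrite lee_fin; exact: trunc_lip.
under [X in X @ _]eq_fun do rewrite u0.
by move/cvg_lim => <- //; rewrite lim_cst.
Unshelve. all: by end_near. Qed.

(** * The exponential law and the bound on the distribution functions *)

(** The density vanishes on the negative half-line, so only the interval from 0 to [t] counts. *)
Lemma exponential_prob_itvNyc (R : realType) (t : R) : 0 < t ->
  exponential_prob 1 [set x | x <= t] = (1 - (expR (- t))%:E)%E.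
Proof.
move=> t0; rewrite -[in expR _](mul1r t) -mulNr -exponential_prob_itv0c//.
rewrite /exponential_prob integral_mkcond [RHS]integral_mkcond.
apply: eq_integral => x _; rewrite !patchE.
rewrite (_ : (x \in [set x | x <= t]) = (x <= t)); last first.
  by apply/idP/idP => [/set_mem|/mem_set].
rewrite mem_setE in_itv/=.
have [x0|x0] := leP 0 x => //=.
by rewrite lt0_exponential_pdf//; case: ifP.
Qed.

Theorem theorem1p1 (R : realType) (d d' : measure_display)
    (T : measurableType d) (T' : measurableType d')
    (P : probability T R) (Q : probability T' R)
    (W W' : {RV P >-> R}) (Z : {RV Q >-> R})
    (hW : forall w, 0 <= W w) (hW' : forall w, 0 <= W' w)
    (hlaw : forall A : set R, measurable A ->
      distribution P W A = distribution P W' A)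
    (hZ : forall A : set R, measurable A ->
      distribution Q Z A = exponential_prob 1 A)
    (D : T -> R) (hD : forall w, D w = W' w - W w)
    (ED ED2 : T -> \bar R)
    (hED : is_cond_exp P W (fun w => (D w)%:E) ED)
    (hED2 : is_cond_exp P W (fun w => (D w ^+ 2)%:E) ED2)
    (t : R) (ht : 0 < t) (lambda : R) (hlambda : 0 < lambda) :
  (`|P [set w | (W w <= t)%R] - Q [set z | (Z z <= t)%R]|
   <= \int[P]_w `|((lambda^-1)%:E * ED w + 1) * (\1_[set w | (0 < W w)%R] w)%:E|
      + \int[P]_w `|((2 * lambda)^-1)%:E * ED2 w - 1|
      + ((6 * lambda)^-1)%:E * 'E_P[(fun w => `|D w| ^+ 3)%R]
      + ((2 * lambda)^-1)%:E
        * 'E_P[(fun w => D w ^+ 2 * \1_[set w | `|W w - t| <= `|D w|] w)%R])%E.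
Proof.
have mD : measurable_fun [set: T] D.
  by rewrite (_ : D = W' \- W); [exact: measurable_funB|exact/funext].
have mD3 : measurable_fun [set: T] (fun w => `|D w| ^+ 3).
  by apply: measurable_funX; exact: measurableT_comp.
have lam0 k : 0 < (k.+1%:R * lambda)^-1 by rewrite invr_gt0 mulr_gt0.
rewrite unlock.
(* If the third moment is infinite, the right-hand side is +oo, since none of its other terms is
   -oo. *)
have [D3oo|D3fin] := eqVneq (\int[P]_w (`|D w| ^+ 3)%:E)%E +oo%E.
  rewrite D3oo gt0_muley ?lte_fin// addey; last first.
    by rewrite gt_eqF// (lt_le_trans (ltNyr 0))// adde_ge0// integral_ge0.
  rewrite addye ?leey// gt_eqF// (lt_le_trans (ltNyr 0))// mule_ge0//.
    by rewrite lee_fin ltW.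
  by rewrite integral_ge0// => w _; rewrite lee_fin mulr_ge0// sqr_ge0.
have iD3 : P.-integrable [set: T] (EFin \o (fun w => `|D w| ^+ 3)).
  apply/integrableP; split; first exact/measurable_EFinP.
  under eq_integral do rewrite gee0_abs ?lee_fin ?exprn_ge0//.
  by rewrite ltey.
(* [1 + |D| ^+ 3] dominates both [|D|] and [D ^+ 2]. *)
have i1D3 : P.-integrable [set: T] (EFin \o (fun w => 1 + `|D w| ^+ 3)).
  exact: integrableD (finite_measure_integrable_cst P 1 measurableT) iD3.
have iD : P.-integrable [set: T] (EFin \o D).
  apply: (le_integrable _ _ _ i1D3) => //; first exact/measurable_EFinP.
  move=> w _ /=; have x0 := normr_ge0 (D w); rewrite lee_fin.
  rewrite [leRHS]ger0_norm ?addr_ge0 ?exprn_ge0//.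
  by have [x1|x1] := leP `|D w| 1; nra.
have iD2 : P.-integrable [set: T] (EFin \o (fun w => D w ^+ 2)).
  apply: (le_integrable _ _ _ i1D3) => //.
    exact/measurable_EFinP/measurable_funX.
  move=> w _ /=; have x0 := normr_ge0 (D w); rewrite lee_fin normrX.
  rewrite [leRHS]ger0_norm ?addr_ge0 ?exprn_ge0//.
  by have [x1|x1] := leP `|D w| 1; nra.
pose c := expR (- t); pose s w := W w - t.
(* The maximum keeps [f] in [0, 1] on the whole line, as pulling out requires. On [0, +oo[, where
   [W] takes its values, it changes nothing. *)
pose f x := Num.max (stein1 (x - t) - c) 0.
have fE w : f (W w) = stein1 (s w) - c.
  rewrite /f max_l// subr_ge0 /stein1 ler_expR le_min oppr_le0 (ltW ht) andbT.
  by have := hW w; lra.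
(* This is the source of the indicator of [0 < W] in the first term of the bound. *)
have f0 w : W w = 0 -> f (W w) = 0.
  by move=> W0; rewrite fE /s W0 sub0r stein1_npos ?oppr_le0 ?(ltW ht)// subrr.
have c0 : 0 <= c by exact: expR_ge0.
have f01 x : 0 <= f x <= 1.
  rewrite /f le_max lexx orbT ge_max ler01 andbT.
  by have /andP[_] := stein1_bounds (x - t); lra.
have msub : measurable_fun [set: R] (fun x => x - t) by exact: measurable_funB.
have mf : measurable_fun [set: R] f.
  apply: measurable_maxr => //; apply: measurable_funB => //.
  by apply: measurableT_comp msub; exact: measurable_stein1.
pose g x := stein0 (x - t).
have g01 x : 0 <= g x <= 1 by exact: stein0_bounds.
have mg : measurable_fun [set: R] g.
  by apply: measurableT_comp msub; exact: measurable_stein0.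
have [mED intED] := cond_exp_pull_out lambda^-1 1 iD hED mf f01.
have [mED2 intED2] := cond_exp_pull_out (2 * lambda)^-1 (-1) iD2 hED2 mg g01.
have iaff (X : T -> R) a b : P.-integrable [set: T] (EFin \o X) ->
    P.-integrable [set: T] (EFin \o (fun w => a * X w + b)).
  move=> iX; exact: integrableD (integrableZl measurableT a iX)
    (finite_measure_integrable_cst P b measurableT).
have iMW (k : R -> R) (X : T -> R) : measurable_fun [set: R] k ->
    (forall x, 0 <= k x <= 1) -> P.-integrable [set: T] (EFin \o X) ->
    P.-integrable [set: T] (EFin \o (fun w => k (W w) * X w)).
  move=> mk k01; apply: integrable_mul_bounded; first exact: measurableT_comp.
  by move=> w; have /andP[? ?] := k01 (W w); rewrite ger0_norm.
pose r w := stein_remainder (s w) (W' w - t).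
have sD w : W' w - t - s w = D w by rewrite hD /s; ring.
have ms : measurable_fun [set: T] s by exact: measurable_funB.
have ms' : measurable_fun [set: T] (fun w => W' w - t).
  exact: measurable_funB.
have mr : measurable_fun [set: T] r.
  rewrite (_ : r = fun w => stein2 (W' w - t) - stein2 (s w) -
      D w * stein1 (s w) - D w ^+ 2 / 2 * stein0 (s w)); last first.
    by apply/funext => w; rewrite /r /stein_remainder sD.
  have m2 := @measurable_stein2 R; have m1 := @measurable_stein1 R.
  have m0 := @measurable_stein0 R.
  apply: measurable_funB; first apply: measurable_funB;
    first apply: measurable_funB.
  - exact: measurableT_comp m2 ms'.
  - exact: measurableT_comp m2 ms.
  - by apply: measurable_funM => //; exact: measurableT_comp m1 ms.
  - apply: measurable_funM; last exact: measurableT_comp m0 ms.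
    by apply: measurable_funM => //; exact: measurable_funX.
have ir : P.-integrable [set: T] (EFin \o r).
  apply: (le_integrable _ _ _ iD2) => //; first exact/measurable_EFinP.
  move=> w _; rewrite lee_fin /= (le_trans (stein_remainder_le2 _ _))//.
  by rewrite sD ger0_norm ?sqr_ge0//; have := sqr_ge0 (D w); lra.
have iDf := iMW f _ mf f01 (iaff _ lambda^-1 1 iD).
have iD2g := iMW g _ mg g01 (iaff _ (2 * lambda)^-1 (-1) iD2).
have ifW : P.-integrable [set: T] (fun w => (f (W w))%:E).
  have := iMW f _ mf f01 (finite_measure_integrable_cst P 1 measurableT).
  by apply: eq_integrable => // w _; rewrite /= mulr1.
have igW : P.-integrable [set: T] (fun w => (g (W w))%:E).
  have := iMW g _ mg g01 (finite_measure_integrable_cst P 1 measurableT).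
  by apply: eq_integrable => // w _; rewrite /= mulr1.
have ifg : P.-integrable [set: T] (fun w => (f (W w) - g (W w))%:E).
  by have := integrableB measurableT ifW igW; apply: eq_integrable.
pose G x := stein2 (x - t) - c * x.
(* Taylor's formula for the antiderivative [G]. The coefficients are written as [1 * _ + 0] and
   [1 / 2 * _ + 0] to fit the affine form of [iaff]. *)
have GE w : G (W' w) - G (W w) =
    f (W w) * (1 * D w + 0) + g (W w) * (1 / 2 * D w ^+ 2 + 0) + r w.
  rewrite /r /stein_remainder fE /G /g -/(s w) sD hD.
  by ring.
have iG : P.-integrable [set: T] (fun w => (G (W' w) - G (W w))%:E).
  have iDf1 := iMW f _ mf f01 (iaff _ 1 0 iD).
  have iD2g1 := iMW g _ mg g01 (iaff _ (1 / 2) 0 iD2).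
  have := integrableD measurableT (integrableD measurableT iDf1 iD2g1) ir.
  by apply: eq_integrable => // w _; rewrite /= GE.
have G0 : (\int[P]_w (G (W' w) - G (W w))%:E = 0)%E.
  apply: integral_eq_law_sub => //; apply: measurable_funB.
    by apply: measurableT_comp msub; exact: measurable_stein2.
  exact: measurable_funM.
(* Stein's equation at [W], integrated: [g - f] is the indicator of [W <= t] minus [1 - c], and
   [1 - c] is the probability of [Z <= t]. *)
have PQ : (P [set w | (W w <= t)%R] - Q [set z | (Z z <= t)%R] =
    \int[P]_w (g (W w) - f (W w))%:E)%E.
  have mt : measurable [set x : R | x <= t].
    by rewrite -set_itvNyc; exact: measurable_itv.
  have -> : Q [set z | (Z z <= t)%R] = (1 - c%:E)%E.
    by have := hZ _ mt; rewrite exponential_prob_itvNyc.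
  have mWt : measurable [set w | (W w <= t)%R].
    by have := measurable_funPTI W mt.
  transitivity (\int[P]_w ((\1_[set w | W w <= t] w)%:E - (1 - c)%:E))%E.
    rewrite integralB_EFin//; last 2 first.
    - exact: integrable_indic.
    - exact: finite_measure_integrable_cst.
    rewrite integral_indic// setIT integral_cst//.
    by rewrite -[X in (_ * X)%E]/(P setT) (@probability_setT _ _ _ P) mule1.
  apply: eq_integral => w _; rewrite -EFinB fE /g -/(s w) indicE.
  rewrite (_ : (w \in _) = (s w <= 0)); last first.
    by rewrite /s subr_le0; apply/idP/idP => [/set_mem|/mem_set].
  congr EFin; have [s0|s0] := leP (s w) 0.
    by rewrite stein0_npos// stein1_npos//=; ring.
  by rewrite stein0_pos// (stein1_nneg (ltW s0))/=; ring.
have key : (P [set w | (W w <= t)%R] - Q [set z | (Z z <= t)%R] =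
    - (\int[P]_w ((f (W w))%:E * ((lambda^-1)%:E * ED w + 1)) +
       \int[P]_w ((g (W w))%:E * (((2 * lambda)^-1)%:E * ED2 w - 1)) +
       \int[P]_w (lambda^-1 * r w)%:E))%E.
  rewrite intED intED2 PQ.
  have ilr := integrableZl measurableT lambda^-1 ir.
  rewrite -integralD// -integralD//; last exact: integrableD.
  (* Adding [lambda^-1] times the increment of [G], whose integral is 0, produces the three
     integrands after expansion by [GE]. *)
  transitivity (- \int[P]_w ((lambda^-1)%:E * (G (W' w) - G (W w))%:E +
    (f (W w) - g (W w))%:E))%E.
    rewrite integralD//; last exact: integrableZl.
    rewrite integralZl// G0 mule0 add0e -integralN; last first.
      exact: integrable_add_def.
    by apply: eq_integral => w _; rewrite -EFinN opprB.
  congr (- _)%E; apply: eq_integral => w _; rewrite GE /= -EFinM -!EFinD.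
  by congr EFin; field; rewrite gt_eqF.
pose A := [set w | (0 < W w)%R].
have mA : measurable A.
  rewrite (_ : A = W @^-1` `]0, +oo[); first exact: measurable_funPTI.
  by apply/seteqP; split => w; rewrite /A /= in_itv/= andbT.
pose B := [set w | `|W w - t| <= `|D w|].
have mB : measurable B.
  have mn : measurable_fun [set: T] (fun w => `|s w|).
    exact: measurableT_comp.
  have mn' : measurable_fun [set: T] (fun w => `|D w|).
    exact: measurableT_comp.
  by rewrite -[B]setTI; exact: measurable_fun_le.
have m1 : measurable_fun [set: T] (fun w => (lambda^-1)%:E * ED w + 1)%E.
  by apply: emeasurable_funD => //; exact: measurable_funeM.
have m2 : measurable_fun [set: T] (fun w => ((2 * lambda)^-1)%:E * ED2 w - 1)%E.
  by apply: emeasurable_funB => //; exact: measurable_funeM.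
have mfW : measurable_fun [set: T] (fun w => (f (W w))%:E).
  exact: measurable_int ifW.
have mgW : measurable_fun [set: T] (fun w => (g (W w))%:E).
  exact: measurable_int igW.
rewrite key abseN.
(* The bound is regrouped in pairs: the integrals with weights [f] and [g] give its first two terms,
   and the remainder [r] gives the last two together. *)
apply: (le_trans (lee_abs_add _ _)); rewrite -[leRHS]addeA; apply: leeD.
  apply: (le_trans (lee_abs_add _ _)); apply: leeD.
    apply: (le_trans (le_abse_integral _ measurableT _)).
      exact: emeasurable_funM.
    apply: ge0_le_integral => //.
    - by apply: measurableT_comp => //; exact: emeasurable_funM.
    - apply: measurableT_comp => //; apply: emeasurable_funM => //.
      exact/measurable_EFinP/measurable_indic.
    - move=> w _; rewrite indicE.
      have [W0|W0] := eqVneq (W w) 0; first by rewrite f0// mul0e abse0.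
      rewrite mem_set ?mule1; last by rewrite /= lt_neqAle eq_sym W0 hW.
      rewrite abseM gee_pMl// lee_fin.
      by have /andP[? ?] := f01 (W w); rewrite ger0_norm.
  apply: (le_trans (le_abse_integral _ measurableT _)).
    exact: emeasurable_funM.
  apply: ge0_le_integral => //.
  - by apply: measurableT_comp => //; exact: emeasurable_funM.
  - exact: measurableT_comp.
  - move=> w _; rewrite abseM gee_pMl// lee_fin.
    by have /andP[? ?] := g01 (W w); rewrite ger0_norm.
have mlr : measurable_fun [set: T] (fun w => (lambda^-1 * r w)%:E).
  by apply/measurable_EFinP; exact: measurable_funM.
have mD2B : measurable_fun [set: T] (fun w => (D w ^+ 2 * \1_B w)%:E).
  apply/measurable_EFinP/measurable_funM; first exact: measurable_funX.
  exact: measurable_indic.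
have mD3E : measurable_fun [set: T] (fun w => (`|D w| ^+ 3)%:E).
  exact/measurable_EFinP.
have D2B0 w : (0 <= (D w ^+ 2 * \1_B w)%:E)%E.
  by rewrite lee_fin mulr_ge0// sqr_ge0.
apply: (le_trans (le_abse_integral _ measurableT _)) => //.
rewrite -!ge0_integralZl_EFin ?(ltW (lam0 _))//.
rewrite -ge0_integralD//; last 4 first.
- by move=> w _; rewrite mule_ge0// lee_fin ltW.
- exact: measurable_funeM.
- by move=> w _; rewrite mule_ge0// lee_fin ltW.
- exact: measurable_funeM.
apply: ge0_le_integral => //.
- exact: measurableT_comp.
- by apply: emeasurable_funD; exact: measurable_funeM.
move=> w _; rewrite -!EFinM -EFinD lee_fin normrM gtr0_norm ?invr_gt0//.
have -> : (6 * lambda)^-1 * `|D w| ^+ 3 +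
    (2 * lambda)^-1 * (D w ^+ 2 * \1_B w) =
    lambda^-1 * (`|D w| ^+ 3 / 6 + D w ^+ 2 / 2 * \1_B w).
  by field; rewrite gt_eqF.
rewrite ler_pM2l ?invr_gt0//.
have := stein_remainder_le (s w) (W' w - t); rewrite sD indicE.
rewrite (_ : (w \in B) = (`|s w| <= `|D w|))//.
by apply/idP/idP => [/set_mem|/mem_set].
Qed.
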